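(* Let $n\ge2$, let $C\subset\mathbb{R}^n$ be a Minkowski-centered convex body with $0$ in its interior, and let $\rho\ge0$. Then $\rho C_{\mathrm{MIN}}$ is a completion of $C$ with respect to the diameter $D_{\mathrm{MIN}}(\cdot,C)$ if and only if $\rho=s(C)=1$ (which means that $C$ is $0$-symmetric).
   Context: A convex body is a nonempty compact convex set. $\|x\|_C=\min\{\lambda\ge0:x\in\lambda C\}$ is the gauge function. The circumradius is $R(K,C)=\inf\{\rho\ge0:\exists t,\ K\subset t+\rho C\}$. The Minkowski asymmetry is $s(C)=R(C,-C)$, and $C$ is Minkowski-centered if $C\subset -s(C)C$. $C$ is $0$-symmetric if $C=-C$. $C_{\mathrm{MIN}}=C\cap(-C)$, and the minimum diameter is $D_{\mathrm{MIN}}(K,C)=\max_{x,y\in K}\|x-y\|_C$. A convex body $K$ is complete (with respect to $D_{\mathrm{MIN}}(\cdot,C)$) if $D_{\mathrm{MIN}}(K',C)>D_{\mathrm{MIN}}(K,C)$ for every convex body $K'\supsetneq K$. A completion of $K$ is a complete convex body $K^*\supset K$ with $D_{\mathrm{MIN}}(K^*,C)=D_{\mathrm{MIN}}(K,C)$. *)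

(* Defs.v *)
From mathcomp Require Import all_boot all_order all_algebra.
From mathcomp Require Import all_classical all_reals all_analysis.

Set Implicit Arguments.
Unset Strict Implicit.
Unset Printing Implicit Defensive.

Import Order.TTheory GRing.Theory Num.Theory.
Import numFieldNormedType.Exports.

Local Open Scope classical_set_scope.
Local Open Scope ring_scope.

Definition convex_body (R : realType) (V : normedModType R) (K : set V) : Prop :=
  [/\ K !=set0, compact K & convex_set K].

Section Gauge.
Context (R : realType) (V : lmodType R).
Implicit Types (K C : set V) (x t : V) (l rho : R).

Definition dilate l C : set V := [set l *: x | x in C].

Definition opp_set C : set V := [set - x | x in C].

Definition translate t C : set V := [set t + x | x in C].

(* The infimum is a minimum when [C] is a convex body with [0] in its
   interior, as the set of admissible [l] is then nonempty and closed. *)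
Definition gauge C x : R := inf [set l | 0 <= l /\ dilate l C x].

Definition circumradius K C : R :=
  inf [set rho | 0 <= rho /\ exists t, K `<=` translate t (dilate rho C)].

Definition minkowski_asymmetry C : R := circumradius C (opp_set C).

Definition minkowski_centered C : Prop :=
  C `<=` dilate (- minkowski_asymmetry C) C.

Definition zero_symmetric C : Prop := C = opp_set C.

Definition C_MIN C : set V := C `&` opp_set C.

(* [x] and [y] range over all ordered pairs, so the value is symmetric even
   though the gauge need not be. The supremum is a maximum when [K] is a convex
   body and [C] a convex body with [0] in its interior. *)
Definition D_MIN K C : R :=
  sup [set d | exists x y, [/\ K x, K y & d = gauge C (x - y)]].

End Gauge.

Section Complete.
Context (R : realType) (V : normedModType R).
Implicit Types K C : set V.

Definition complete_body C K : Prop :=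
  convex_body K /\
  forall K', convex_body K' -> K `<` K' -> D_MIN K C < D_MIN K' C.

Definition is_completion C K Kstar : Prop :=
  [/\ complete_body C Kstar, K `<=` Kstar & D_MIN Kstar C = D_MIN K C].

End Complete.

(* Main.v *)
Require Import Defs.
From mathcomp Require Import all_boot all_order all_algebra.
From mathcomp Require Import all_classical all_reals all_analysis.
From mathcomp Require Import ring lra.

Import Order.TTheory GRing.Theory Num.Theory.
Import numFieldNormedType.Exports.

Local Open Scope classical_set_scope.
Local Open Scope ring_scope.

(** Write [s] for the Minkowski asymmetry of [C] and [M] for [C_MIN C]; [M] is
    symmetric and contained in [C]. Comparing diameters is enough to exclude
    every non-symmetric case:
    - [D_MIN C C <= 1 + s], because a point [y] of [C] has the form [- s *: z]
      with [z] in [C], so that [x - y = x + s *: z] lies in [(1 + s) C]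
      ([D_MIN_self_le]);
    - [D_MIN (rho M) C >= 2 rho], because some [x] with [x] and [- x] both in
      [C] lies on the boundary of [C] ([symmetric_boundary_point]), and
      [rho *: x], [- rho *: x] are points of [rho M];
    - [C `<=` rho M] gives [C `<=` - rho C], hence [s <= rho].
    If [rho M] is a completion of [C], its diameter is that of [C], so
    [2 s <= 2 rho <= 1 + s]; since always [1 <= s] ([asymmetry_ge1]), this
    forces [rho = s = 1].

    Conversely [s = 1] makes the centering inclusion read [C `<=` - C], so [C]
    is symmetric and equal to [M]. A symmetric [C] has diameter at most [2], and
    it is complete since a body containing [C] and a point [x] outside [C] also
    contains the antipodal boundary point [- x / g], where [g] is the gauge of
    [x], at distance [g + 1 > 2] from [x] ([symmetric_complete]). *)

Section ConvexBodyGauge.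
Set Implicit Arguments.
Unset Strict Implicit.
Context {R : realType} {V : normedModType R} {C : set V}.
Context (C_body : convex_body C) (C_int0 : C° (0 : V)).

Lemma body_conv (x y : V) (l : R) :
  0 <= l -> l <= 1 -> C x -> C y -> C (l *: x + (1 - l) *: y).
Proof.
case: C_body => _ _ cvC l0 l1 Cx Cy.
have li : Itv.spec (@Itv.num_sem R) (Itv.Real `[0%Z, 1%Z]) l.
  rewrite /= /Itv.num_sem /= in_itv /= num_real /=.
  by rewrite l0 l1.
have := cvC x y (Itv.mk li); rewrite !inE => /(_ Cx Cy).
by [].
Qed.

Lemma body_0 : C 0.
Proof. exact: interior_subset. Qed.

Lemma body_scale (x : V) (l : R) : 0 <= l -> l <= 1 -> C x -> C (l *: x).
Proof.
move=> l0 l1 Cx.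
by have := body_conv l0 l1 Cx body_0; rewrite scaler0 addr0.
Qed.

Lemma compact_norm_le (K : set V) : compact K ->
  exists2 B : R, 0 < B & forall x, K x -> `|x| <= B.
Proof.
move=> /compact_bounded [M [_ HM]].
exists (`|M| + 1); first by rewrite ltr_wpDl.
by apply: HM; rewrite (le_lt_trans (ler_norm M)) // ltrDl.
Qed.

(** The interior point [0] makes [C] absorbing, uniformly in the norm.
    This is why every gauge is an infimum of a nonempty set, and why compact
    sets have bounded gauge and so a genuine diameter. *)
Lemma norm_lt_dilate : exists2 e : R, 0 < e &
  forall (x : V) (l : R), 0 < l -> `|x| < e * l -> dilate l C x.
Proof.
have /nbhs_ballP [e /= e0 eC] := C_int0.
exists e => // x l l0 xl; exists (l^-1 *: x); last by rewrite scalerKV ?lt0r_neq0.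
apply: eC; rewrite -ball_normE /= sub0r normrN normrZ gtr0_norm ?invr_gt0 //.
by rewrite mulrC ltr_pdivrMr.
Qed.

Lemma gauge_le (c : V) (l : R) : 0 <= l -> C c -> gauge C (l *: c) <= l.
Proof.
move=> l0 Cc; apply: ge_inf; first by exists 0 => m [].
by split=> //; exists c.
Qed.

Lemma norm_gauge_bounded (B : R) : exists d : R,
  forall x, `|x| <= B -> gauge C x <= d.
Proof.
have [e e0 eC] := norm_lt_dilate.
have l0 : 0 < e^-1 * (`|B| + 1) by rewrite mulr_gt0 ?invr_gt0 // ltr_wpDl.
exists (e^-1 * (`|B| + 1)) => x xB.
have [|c Cc <-] := eC x _ l0; last by apply: gauge_le => //; exact: ltW.
rewrite mulVKf ?lt0r_neq0 // (le_lt_trans xB) //.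
by rewrite (le_lt_trans (ler_norm B)) // ltrDl.
Qed.

Lemma dilate_ex (x : V) : [set l | 0 <= l /\ dilate l C x] !=set0.
Proof.
have [e e0 eC] := norm_lt_dilate.
have l0 : 0 < e^-1 * (`|x| + 1) by rewrite mulr_gt0 ?invr_gt0 // ltr_wpDl.
exists (e^-1 * (`|x| + 1)); split; first exact: ltW.
by apply: eC => //; rewrite mulVKf ?lt0r_neq0 // ltrDl.
Qed.

Lemma gaugeZ_le (x : V) (l : R) : 0 < l -> gauge C (l *: x) <= l * gauge C x.
Proof.
move=> l0; rewrite mulrC -ler_pdivrMr //.
apply: lb_le_inf; first exact: dilate_ex.
move=> m [m0 [c Cc <-]]; rewrite scalerA ler_pdivrMr // mulrC.
by rewrite mulrC (mulrC l); apply: gauge_le => //; rewrite mulr_ge0 // ltW.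
Qed.

Lemma gaugeZ (x : V) (l : R) : 0 < l -> gauge C (l *: x) = l * gauge C x.
Proof.
move=> l0; apply/eqP; rewrite eq_le gaugeZ_le //=.
have := gaugeZ_le (l *: x) (l := l^-1); rewrite invr_gt0 => /(_ l0).
by rewrite scalerK ?lt0r_neq0 // mulrC ler_pdivlMr // mulrC.
Qed.

Lemma gauge_gt0 (x : V) : x != 0 -> 0 < gauge C x.
Proof.
move=> x0; case: (C_body) => _ /compact_norm_le [B B0 CB] _.
apply: (@lt_le_trans _ _ (`|x| / B)); first by rewrite divr_gt0 ?normr_gt0.
apply: lb_le_inf; first exact: dilate_ex.
move=> m [m0 [c Cc <-]]; rewrite normrZ ger0_norm // ler_pdivrMr //.
by rewrite ler_wpM2l // CB.
Qed.

(** The gauge is defined as an infimum; this says that it is attained at level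
    [1]. If [x = l *: c] with [c] in [C] and [l] only slightly above [1], then
    [c] is within [(l - 1) B] of [x], where [B] bounds the norm on [C]; so [x]
    is a limit of points of the closed set [C]. *)
Lemma gauge_le1 (x : V) : gauge C x <= 1 -> C x.
Proof.
move=> x1; case: (C_body) => _ cC _.
have [B B0 CB] := compact_norm_le cC.
have clC : closed C by apply: compact_closed cC; exact: norm_hausdorff.
apply: clC => U /nbhs_ballP [e /= e0 eU].
have [|l [l0 [c Cc lx]] le] := @inf_lt _ _ (1 + e / B) (dilate_ex x).
  by rewrite (le_lt_trans x1) // ltrDl divr_gt0.
have [l1|l1] := leP l 1.
  exists x; split; last by apply: eU; exact: ballxx.
  by rewrite -lx; apply: body_scale.
exists c; split => //; apply: eU.
rewrite -ball_normE /= -lx -{2}[c]scale1r -scalerBl normrZ.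
rewrite gtr0_norm ?subr_gt0 //.
apply: (@le_lt_trans _ _ ((l - 1) * B)).
  by rewrite ler_wpM2l ?CB // subr_ge0 ltW.
by rewrite -ltr_pdivlMr // ltrBlDl.
Qed.

(** Convexity in the form of subadditivity: [a C + b C] is contained in
    [(a + b) C]. *)
Lemma gauge_comb (x y : V) (a b : R) : 0 <= a -> 0 <= b -> C x -> C y ->
  gauge C (a *: x + b *: y) <= a + b.
Proof.
move=> a0 b0 Cx Cy; have [ab|ab] := leP (a + b) 0.
  have -> : a = 0 by lra.
  have -> : b = 0 by lra.
  by rewrite !scale0r !addr0; have := gauge_le (lexx 0) body_0; rewrite scale0r.
have -> : a *: x + b *: y
    = (a + b) *: ((a / (a + b)) *: x + (1 - a / (a + b)) *: y).
  rewrite scalerDr !scalerA; congr (_ *: _ + _ *: _); field;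
    by rewrite lt0r_neq0.
apply: gauge_le; first exact: ltW.
by apply: body_conv => //; rewrite ?divr_ge0 ?ler_pdivrMr // ?mul1r; lra.
Qed.

Lemma le_D_MIN (K : set V) (x y : V) : compact K -> K x -> K y ->
  gauge C (x - y) <= D_MIN K C.
Proof.
move=> /compact_norm_le [B B0 KB] Kx Ky.
apply: ub_le_sup; last by exists x, y.
have [d Bd] := norm_gauge_bounded (B + B).
exists d => _ [u [v [Ku Kv ->]]]; apply: Bd.
by apply: (le_trans (ler_normB _ _)); apply: lerD; exact: KB.
Qed.

Lemma asymmetry_ge0 : 0 <= minkowski_asymmetry C.
Proof.
rewrite /minkowski_asymmetry /circumradius; set E := (X in inf X).
have [E0|/set0P E0] := eqVneq E set0; first by rewrite E0 inf0.
by apply: lb_le_inf => // r [].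
Qed.

(** The asymmetry allows an arbitrary translation; an upper bound needs only
    the trivial one. *)
Lemma asymmetry_le (r : R) : 0 <= r -> C `<=` dilate r (opp_set C) ->
  minkowski_asymmetry C <= r.
Proof.
move=> r0 Cr; apply: ge_inf; first by exists 0 => m [].
split=> //; exists 0 => x /Cr xr; exists x => //.
by rewrite add0r.
Qed.

(** Centering turns the subtracted point of [C] into [s] times a point of [C],
    so every difference lies in [C + s C]. *)
Lemma D_MIN_self_le : minkowski_centered C ->
  D_MIN C C <= 1 + minkowski_asymmetry C.
Proof.
move=> Cs; case: (C_body) => [[c Cc] _ _].
apply: ge_sup; first by exists (gauge C (c - c)), c, c.
move=> d [x [y [Cx /Cs [z Cz <-] ->]]].
rewrite scaleNr opprK -{1}[x]scale1r.
by apply: gauge_comb => //; exact: asymmetry_ge0.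
Qed.

(** Along any line through [0], the nearer of the two boundary points of [C]
    has its antipode in [C]. *)
Lemma symmetric_boundary_point (v : V) : v != 0 ->
  exists x, [/\ C x, C (- x) & gauge C x = 1].
Proof.
(* Replacing v by - v, the ray of v meets the boundary first. *)
wlog vN : v / gauge C (- v) <= gauge C v.
  move=> W v0; have [|/ltW vN] := leP (gauge C (- v)) (gauge C v).
    by move/W; exact.
  by apply: (W (- v)); rewrite ?opprK // oppr_eq0.
move=> v0; have g0 := gauge_gt0 v0.
exists ((gauge C v)^-1 *: v).
have g1 : gauge C ((gauge C v)^-1 *: v) = 1.
  by rewrite gaugeZ ?invr_gt0 // mulVf ?lt0r_neq0.
split=> //; apply: gauge_le1; first by rewrite g1.
by rewrite -scalerN gaugeZ ?invr_gt0 // mulrC ler_pdivrMr // mul1r.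
Qed.

(** Applying the centering inclusion twice gives [C `<=` s ^ 2 C], which at a
    boundary point of [C] reads [1 <= s ^ 2]. *)
Lemma asymmetry_ge1 (v : V) : v != 0 -> minkowski_centered C ->
  1 <= minkowski_asymmetry C.
Proof.
move=> v0 Cs; have s0 := asymmetry_ge0.
have [x [Cx _ gx]] := symmetric_boundary_point v0.
have [y Cy yx] := Cs _ Cx; have [z Cz zy] := Cs _ Cy.
have := gauge_le (mulr_ge0 s0 s0) Cz.
rewrite -mulrNN -scalerA zy yx gx => s2.
by rewrite -(@ler_pXn2r _ 2) ?nnegrE // expr1n expr2 -mulrNN.
Qed.

Lemma asymmetry1_symmetric : minkowski_centered C ->
  minkowski_asymmetry C = 1 -> zero_symmetric C.
Proof.
rewrite /minkowski_centered => Cs s1; rewrite s1 in Cs.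
apply/seteqP; split=> x.
  by move=> /Cs [y Cy <-]; exists y => //; rewrite scaleN1r.
by move=> [y /Cs [z Cz <-] <-]; rewrite scaleN1r opprK.
Qed.

Lemma symmetric_asymmetry_le1 : zero_symmetric C -> minkowski_asymmetry C <= 1.
Proof.
move=> CN; apply: asymmetry_le => // x Cx.
by exists x; rewrite -?CN // scale1r.
Qed.

(** A point [x] outside [C] has gauge [g > 1], and symmetry puts [- x / g] in
    [C]; the difference is [(1 + 1 / g) x], of gauge [g + 1]. *)
Lemma symmetric_complete : zero_symmetric C -> D_MIN C C <= 2 ->
  complete_body C C.
Proof.
move=> CN D2; split=> // K [_ cK _] [CK KC].
apply: (le_lt_trans D2).
have [x [Kx nCx]] : exists x, K x /\ ~ C x.
  by apply: contra_notP KC => /forallNP H x Kx; apply: contrapT => nC; apply: (H x).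
have g1 : 1 < gauge C x by rewrite ltNge; apply/negP => /gauge_le1.
have g0 := lt_trans ltr01 g1.
have Cy : C (- ((gauge C x)^-1 *: x)).
  suff: opp_set C (- ((gauge C x)^-1 *: x)) by rewrite -CN.
  exists ((gauge C x)^-1 *: x) => //; apply: gauge_le1.
  by rewrite gaugeZ ?invr_gt0 // mulVf ?lt0r_neq0.
apply: (lt_le_trans _ (le_D_MIN cK Kx (CK _ Cy))).
rewrite opprK -{1}[x]scale1r -scalerDl gaugeZ ?addr_gt0 ?invr_gt0 //.
by rewrite mulrDl mul1r mulVf ?lt0r_neq0 //; lra.
Qed.

(** The diameter of [rho M] is at least [2 rho] and that of [C] at most [1 + s],
    while the inclusion forces [s <= rho]; with [1 <= s] only one value is
    left. *)
Lemma completion_asymmetry (v : V) (rho : R) : v != 0 -> minkowski_centered C ->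
  0 <= rho -> is_completion C C (dilate rho (C_MIN C)) ->
  rho = minkowski_asymmetry C /\ minkowski_asymmetry C = 1.
Proof.
move=> v0 Cs rho0 [[[_ cM _] _] CM DE].
have s1 := asymmetry_ge1 v0 Cs.
have s_rho : minkowski_asymmetry C <= rho.
  by apply: asymmetry_le => // x /CM [y [_ Cy] <-]; exists y.
have [x [Cx CNx gx]] := symmetric_boundary_point v0.
have Mx : C_MIN C x by split=> //; exists (- x) => //; rewrite opprK.
have MNx : C_MIN C (- x) by split=> //; exists x.
have Mrx : dilate rho (C_MIN C) (rho *: x) by exists x.
have MrNx : dilate rho (C_MIN C) (rho *: - x) by exists (- x).
have := le_D_MIN cM Mrx MrNx.
rewrite scalerN opprK -scalerDl gaugeZ ?gx ?DE; last by lra.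
have := D_MIN_self_le Cs; split; lra.
Qed.

End ConvexBodyGauge.

Theorem lemma6p2 (R : realType) (n : nat) (n_ge2 : (2 <= n)%N)
    (C : set 'rV[R]_n) (C_body : convex_body C)
    (C_centered : minkowski_centered C) (C_int0 : C° (0 : 'rV[R]_n))
    (rho : R) (rho_ge0 : 0 <= rho) :
  (is_completion C C (dilate rho (C_MIN C)) <->
     rho = minkowski_asymmetry C /\ minkowski_asymmetry C = 1) /\
  (minkowski_asymmetry C = 1 <-> zero_symmetric C).
Proof.
have [v v0] : exists v : 'rV[R]_n, v != 0.
  case: n n_ge2 {C C_body C_centered C_int0} => // m _.
  by exists (const_mx 1); apply/eqP => /rowP /(_ 0); rewrite !mxE => /eqP; rewrite oner_eq0.
split; split.
- exact: (completion_asymmetry C_body C_int0 v0).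
- move=> [-> s1].
  have CN := asymmetry1_symmetric C_centered s1.
  have -> : dilate (minkowski_asymmetry C) (C_MIN C) = C.
    rewrite s1 /C_MIN -CN setIid; apply/seteqP; split=> x.
      by move=> [y Cy <-]; rewrite scale1r.
    by move=> Cx; exists x => //; rewrite scale1r.
  split=> //; apply: symmetric_complete => //.
  by have := D_MIN_self_le C_body C_int0 C_centered; rewrite s1.
- exact: asymmetry1_symmetric.
- move=> CN; apply/eqP; rewrite eq_le symmetric_asymmetry_le1 //=.
  exact: (asymmetry_ge1 C_body C_int0 v0).
Qed.
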